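(* Let $\hat\Sigma$ and $\Sigma^+$ be the matrices produced in steps (2) and (3) of DP-Thresholding. Then $$\mathbb{E}\|\hat\Sigma-\Sigma\|_2^2=O\Big(\frac{s^2\log p\,\log(1/\delta)}{n\epsilon^2}\Big)\quad\text{and}\quad \mathbb{E}\|\Sigma^+-\Sigma\|_2^2=O\Big(\frac{s^2\log p\,\log(1/\delta)}{n\epsilon^2}\Big),$$ where $\|\cdot\|_2$ is the spectral norm, the expectation is over both the samples and the algorithm's noise, and the implied constants depend only on $\sigma^2$.
   Context: Setting: $x_1,\dots,x_n$ are i.i.d. random vectors in $\mathbb{R}^p$ (high-dimensional regime $p\gg n\ge \mathrm{poly}(\log p)$) with $\mathbb{E}x_i=0$, $\|x_i\|_2\le 1$ almost surely, sub-Gaussian with parameter $\sigma^2$: $\mathbb{P}\{|v^Tx_i|>t\}\le e^{-t^2/(2\sigma^2)}$ for all $t>0$ and all unit vectors $v$. The covariance $\Sigma=(\sigma_{ij})$ lies in $\mathcal{G}_0(s)$: for each column $j$, the vector of off-diagonal entries $(\sigma_{ij})_{i\neq j}$ has at most $s$ nonzeros. $\Sigma^*=(\sigma^*_{ij})=\frac1n\sum_i x_ix_i^T$. The constant $\gamma>0$ (depending only on $\sigma^2$) is one for which there is a constant $C_1$ with $\mathbb{P}(|\sigma^*_{ij}-\sigma_{ij}|>t)\le C_1e^{-8nt^2/\gamma^2}$ for all $i,j$ and all sufficiently small $|t|$, in particular $\mathbb{P}(|\sigma^*_{ij}-\sigma_{ij}|>\gamma\sqrt{\log p/n})\le C_1p^{-8}$.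 DP-Thresholding algorithm with input $0<\epsilon,\delta\le1$: (1) $\tilde\Sigma=(\tilde\sigma_{ij})=\Sigma^*+N$, where $N$ is a symmetric $p\times p$ matrix whose upper-triangular entries (including the diagonal) are i.i.d. $\mathcal{N}(0,\sigma_1^2)$, independent of the data, with $\sigma_1^2=\frac{2\ln(1.25/\delta)}{n^2\epsilon^2}$, lower triangle copied from upper; (2) $\hat\sigma_{ij}=\tilde\sigma_{ij}\cdot\mathbb{I}[|\tilde\sigma_{ij}|>\tau]$ with $\tau=\gamma\sqrt{\frac{\log p}{n}}+\frac{4\sqrt{2\ln(1.25/\delta)}\sqrt{\log p}}{n\epsilon}$; (3) with eigendecomposition $\hat\Sigma=\sum_i\lambda_iv_iv_i^T$, output $\Sigma^+=\sum_i\max\{\lambda_i,0\}v_iv_i^T$.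
   Formalization: The factor log(1/δ) in the rate is replaced by log(1.25/δ), and s ≥ 1 is assumed: at δ = 1 or s = 0 the stated rate is 0 while the expected error is positive. For δ bounded away from 1 the two rates agree up to constants. *)

(* Defs.v *)
From HB Require Import structures.
From mathcomp Require Import all_boot all_order all_algebra.
From mathcomp Require Import all_classical all_reals all_analysis.
Set Implicit Arguments. Unset Strict Implicit. Unset Printing Implicit Defensive.
Import Order.TTheory GRing.Theory Num.Theory.
Local Open Scope classical_set_scope.
Local Open Scope ring_scope.

Section DPThresholding.
Variable R : realType.

Definition vnorm2 p (v : 'cV[R]_p) : R := Num.sqrt (\sum_(k < p) v k 0 ^+ 2).

Definition spec_norm p (A : 'M[R]_p) : R :=
  sup [set vnorm2 (A *m v) | v in [set v : 'cV[R]_p | vnorm2 v = 1]].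

Definition in_G0 p (s : nat) (S : 'M[R]_p) : Prop :=
  forall j : 'I_p, (#|[set i : 'I_p | (i != j) && (S i j != 0%R)]| <= s)%N.

Definition sample_cov n p (xs : 'I_n -> 'I_p -> R) : 'M[R]_p :=
  \matrix_(a, b) (n%:R^-1 * \sum_(l < n) xs l a * xs l b).

Definition sym_noise p (z : 'I_p -> 'I_p -> R) : 'M[R]_p :=
  \matrix_(a, b) (if (a <= b)%N then z a b else z b a).

Definition dp_sigma1 (n : nat) (eps delta : R) : R :=
  Num.sqrt (2 * ln (5 / 4 / delta)) / (n%:R * eps).

Definition dp_tau (gamma : R) (n p : nat) (eps delta : R) : R :=
  gamma * Num.sqrt (ln p%:R / n%:R)
  + 4 * Num.sqrt (2 * ln (5 / 4 / delta)) * Num.sqrt (ln p%:R) / (n%:R * eps).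

Definition dp_threshold n p (tau : R) (xs : 'I_n -> 'I_p -> R)
    (z : 'I_p -> 'I_p -> R) : 'M[R]_p :=
  let St := sample_cov xs + sym_noise z in
  \matrix_(a, b) (if tau < `|St a b| then St a b else 0).

Definition psd_projection p (A B : 'M[R]_p) : Prop :=
  exists (U : 'M[R]_p) (lam : 'rV[R]_p),
    U^T *m U = 1%:M /\
    A = U *m diag_mx lam *m U^T /\
    B = U *m diag_mx (\row_i Num.max (lam 0 i) 0) *m U^T.

Context {d : measure_display} {T : measurableType d}.

(** Mutual independence of the n random vectors x_1..x_n (each as a whole)
    and of the scalar noise entries z a b (a <= b): product rule on all
    finite-dimensional rectangle events (these form a pi-system generating
    the relevant sigma-algebras). *)
Definition dp_independent (P : probability T R) n p
    (x : 'I_n -> T -> 'I_p -> R) (z : 'I_p -> 'I_p -> T -> R) : Prop :=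
  forall (A : 'I_n -> 'I_p -> set R) (B : 'I_p -> 'I_p -> set R),
    (forall i k, measurable (A i k)) -> (forall a b, measurable (B a b)) ->
    fine (P [set w | (forall i k, A i k (x i w k)) /\
                     (forall a b : 'I_p, (a <= b)%N -> B a b (z a b w))])
    = (\prod_(i < n) fine (P [set w | forall k, A i k (x i w k)]))
      * \prod_(a < p) \prod_(b < p | (a <= b)%N) fine (P (z a b @^-1` B a b)).

Definition ident_distrib (P : probability T R) n p
    (x : 'I_n -> T -> 'I_p -> R) : Prop :=
  forall (i j : 'I_n) (A : 'I_p -> set R), (forall k, measurable (A k)) ->
    P [set w | forall k, A k (x i w k)] = P [set w | forall k, A k (x j w k)].

End DPThresholding.

(* Main.v *)
Require Import Defs.
From HB Require Import structures.
From mathcomp Require Import all_boot all_order all_algebra.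
From mathcomp Require Import all_classical all_reals all_analysis.
From mathcomp Require Import measurable_realfun ring lra.
Import Order.TTheory GRing.Theory Num.Theory.
Local Open Scope classical_set_scope.
Local Open Scope ring_scope.

(** On the event where every [|sigma*_ij - sigma_ij|] is at most
    [t = gamma sqrt (ln p / n)] and every noise entry at most
    [4 sigma_1 sqrt (ln p)], each thresholded entry is off by at most [2 tau]
    and vanishes wherever [Sigma] does, so Schur's test gives
    [|hat Sigma - Sigma|_2 <= 4 s tau].  Off that event the Frobenius norm is
    enough: entries are bounded by [1] almost surely up to noise, and the single
    exponential moment [E exp (15 N^2 / (32 sigma_1^2)) = 4] of the Gaussian
    noise dominates both its tail and the part of its second moment carried by
    the bad event, by negative powers of [p >= n].  Finally the projection onto
    the positive semidefinite cone at most doubles the error, since [Sigma]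
    itself is positive semidefinite. *)

(** * Spectral norm: Cauchy-Schwarz, Frobenius bound and Schur's test *)

Lemma cauchy_schwarz_sum {R : realType} {I : finType} (f g : I -> R) :
  (\sum_i f i * g i) ^+ 2 <= (\sum_i f i ^+ 2) * (\sum_i g i ^+ 2).
Proof.
set C := \sum_i f i * g i; set A := \sum_i f i ^+ 2; set B := \sum_i g i ^+ 2.
have B0 : 0 <= B by apply: sumr_ge0 => i _; exact: sqr_ge0.
have [BE|Bneq0] := eqVneq B 0.
  have g0 i : g i = 0.
    move/eqP: BE; rewrite psumr_eq0 => [/allP/(_ i)|j _]; last exact: sqr_ge0.
    by rewrite mem_index_enum sqrf_eq0 => /(_ isT)/eqP.
  by rewrite BE mulr0 /C big1 ?expr0n// => i _; rewrite g0 mulr0.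
have Bgt0 : 0 < B by rewrite lt_neqAle eq_sym Bneq0.
(* Expanding this sum of squares gives [B * (A * B - C ^+ 2)], and [B > 0] can then be cancelled. *)
have : 0 <= \sum_i (B * f i - C * g i) ^+ 2.
  by apply: sumr_ge0 => i _; exact: sqr_ge0.
have -> : \sum_i (B * f i - C * g i) ^+ 2 = B * (A * B - C ^+ 2).
  under eq_bigr => i _.
    rewrite (_ : _ ^+ 2 = B ^+ 2 * f i ^+ 2 + (- (B * C *+ 2) * (f i * g i) +
      C ^+ 2 * g i ^+ 2)); last ring.
    over.
  by rewrite !big_split/= -!mulr_sumr -/A -/B -/C; ring.
by rewrite pmulr_rge0// subr_ge0.
Qed.

Lemma vnorm2_ge0 {R : realType} p (v : 'cV[R]_p) : 0 <= vnorm2 v.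
Proof. exact: sqrtr_ge0. Qed.

Lemma vnorm2_sqr {R : realType} p (v : 'cV[R]_p) :
  vnorm2 v ^+ 2 = \sum_(k < p) v k 0 ^+ 2.
Proof. by rewrite sqr_sqrtr// sumr_ge0// => k _; exact: sqr_ge0. Qed.

Lemma vnorm2_mulmx_le_frobenius {R : realType} p (A : 'M[R]_p) (v : 'cV[R]_p) :
  vnorm2 (A *m v) ^+ 2 <= (\sum_i \sum_j A i j ^+ 2) * vnorm2 v ^+ 2.
Proof.
rewrite !vnorm2_sqr mulr_suml ler_sum// => i _.
by rewrite mxE cauchy_schwarz_sum.
Qed.

Lemma sum_sqr_ge0 {R : realType} p (A : 'M[R]_p) :
  0 <= \sum_i \sum_j A i j ^+ 2.
Proof.
by apply: sumr_ge0 => i _; apply: sumr_ge0 => j _; exact: sqr_ge0.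
Qed.

(** A real [sup] bounds its set only if the set is bounded above; the Frobenius norm supplies such a
    bound. *)
Lemma vnorm2_mulmx_le_spec {R : realType} p (A : 'M[R]_p) (v : 'cV[R]_p) :
  vnorm2 v = 1 -> vnorm2 (A *m v) <= spec_norm A.
Proof.
move=> v1; apply: ub_le_sup; last by exists v.
exists (Num.sqrt (\sum_i \sum_j A i j ^+ 2)) => _ [u u1 <-].
rewrite -(@ler_pXn2r _ 2) ?nnegrE ?vnorm2_ge0 ?sqrtr_ge0//.
rewrite [leRHS]sqr_sqrtr ?sum_sqr_ge0//.
by apply: le_trans (vnorm2_mulmx_le_frobenius _ _ _) _; rewrite u1 expr1n mulr1.
Qed.

(** Keeps the [sup] in [spec_norm] away from its default value on the empty set. *)
Lemma exists_unit_vector {R : realType} p : (0 < p)%N ->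
  exists v : 'cV[R]_p, vnorm2 v = 1.
Proof.
case: p => // p _; exists (delta_mx 0 0).
rewrite /vnorm2 (bigD1 0)//= big1 => [|k k0]; rewrite !mxE ?eqxx.
  by rewrite addr0 expr1n sqrtr1.
by rewrite (negbTE k0) expr0n.
Qed.

Lemma spec_norm_ge0 {R : realType} p (A : 'M[R]_p) :
  (0 < p)%N -> 0 <= spec_norm A.
Proof.
move=> /(@exists_unit_vector R)[v v1].
exact: le_trans (vnorm2_ge0 _ _) (vnorm2_mulmx_le_spec _ _ _ v1).
Qed.

Lemma spec_norm_le {R : realType} p (A : 'M[R]_p) (B : R) : (0 < p)%N ->
  0 <= B -> (forall v, vnorm2 v = 1 -> vnorm2 (A *m v) ^+ 2 <= B ^+ 2) ->
  spec_norm A <= B.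
Proof.
move=> /(@exists_unit_vector R)[v v1] B0 AB; apply: ge_sup.
  by exists (vnorm2 (A *m v)), v.
move=> _ [u u1 <-].
by rewrite -(@ler_pXn2r _ 2) ?nnegrE ?vnorm2_ge0// AB.
Qed.

Lemma spec_norm_sqr_le_frobenius {R : realType} p (A : 'M[R]_p) : (0 < p)%N ->
  spec_norm A ^+ 2 <= \sum_i \sum_j A i j ^+ 2.
Proof.
move=> p0.
have F0 := sum_sqr_ge0 _ A.
rewrite -[leRHS]sqr_sqrtr// ler_pXn2r ?nnegrE ?spec_norm_ge0 ?sqrtr_ge0//.
apply: spec_norm_le; rewrite ?sqrtr_ge0// => v v1.
rewrite [leRHS]sqr_sqrtr//.
by apply: le_trans (vnorm2_mulmx_le_frobenius _ _ _) _; rewrite v1 expr1n mulr1.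
Qed.

(** Schur's test in the symmetric case, where row sums and column sums coincide. *)
Lemma spec_norm_le_col_sum {R : realType} p (A : 'M[R]_p) (B : R) : (0 < p)%N ->
  0 <= B -> (forall i j, A i j = A j i) ->
  (forall j, \sum_i `|A i j| <= B) -> spec_norm A <= B.
Proof.
move=> p0 B0 symA AB; apply: spec_norm_le => // v v1.
rewrite vnorm2_sqr.
apply: (@le_trans _ _ (\sum_i B * \sum_j `|A i j| * v j 0 ^+ 2)).
  apply: ler_sum => i _; rewrite mxE.
  have sq j : Num.sqrt `|A i j| ^+ 2 = `|A i j| by rewrite sqr_sqrtr.
  have -> : (\sum_j A i j * v j 0) ^+ 2 = `|\sum_j A i j * v j 0| ^+ 2.
    by rewrite real_normK ?num_real.
  (* Splitting [|A i j|] into two square roots makes Cauchy-Schwarz yield a row sum, at most [B] by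
     symmetry, times [\sum_j |A i j| v_j^2]; summing the latter over [i] produces column sums and a
     second factor [B]. *)
  apply: (@le_trans _ _ ((\sum_j Num.sqrt `|A i j| *
      (Num.sqrt `|A i j| * `|v j 0|)) ^+ 2)).
    rewrite ler_pXn2r ?nnegrE//; last first.
      by apply: sumr_ge0 => j _; rewrite !mulr_ge0 ?sqrtr_ge0.
    apply: le_trans (ler_norm_sum _ _ _) _.
    by apply: ler_sum => j _; rewrite normrM mulrA -expr2 sq.
  apply: le_trans (cauchy_schwarz_sum _ _) _.
  under eq_bigr do rewrite sq.
  under [X in _ * X]eq_bigr do rewrite exprMn sq real_normK ?num_real//.
  apply: ler_wpM2r; last by under eq_bigr do rewrite symA; exact: AB.
  by apply: sumr_ge0 => j _; rewrite mulr_ge0 ?sqr_ge0.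
rewrite -mulr_sumr exchange_big/= expr2 ler_wpM2l//.
rewrite -[leRHS]mulr1 -[in leRHS](expr1n R 2) -v1 vnorm2_sqr mulr_sumr.
apply: ler_sum => j _; rewrite -mulr_suml ler_wpM2r ?sqr_ge0//.
Qed.

(** * Projection onto the positive semidefinite cone *)

Lemma vnorm2_orthogonal {R : realType} p (U : 'M[R]_p) (v : 'cV[R]_p) :
  U^T *m U = 1%:M -> vnorm2 (U *m v) = vnorm2 v.
Proof.
have dotE (w : 'cV[R]_p) : \sum_k w k 0 ^+ 2 = (w^T *m w) 0 0.
  by rewrite mxE; apply: eq_bigr => k _; rewrite mxE expr2.
move=> UU; rewrite /vnorm2 !dotE trmx_mul -mulmxA (mulmxA U^T) UU.
by rewrite mul1mx.
Qed.

(* An eigenvector [u] of [A] for a negative eigenvalue [l] has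
   [-l <= u^T (S - A) u] because [u^T S u >= 0]. *)
Lemma spec_norm_psd_projection {R : realType} p (A B S : 'M[R]_p) :
  (0 < p)%N -> psd_projection A B ->
  (forall v : 'cV[R]_p, 0 <= (v^T *m S *m v) 0 0) ->
  spec_norm (B - S) <= 2 * spec_norm (A - S).
Proof.
move=> p0 [U [lam [UU [AE BE]]]] psdS.
set rho := spec_norm (A - S).
have rho0 : 0 <= rho by exact: spec_norm_ge0.
have lam_ge i : - lam 0 i <= rho.
  pose u : 'cV[R]_p := U *m delta_mx i 0.
  have u1 : vnorm2 u = 1.
    rewrite /u vnorm2_orthogonal// /vnorm2 (bigD1 i)//= big1 => [|k ki].
      by rewrite !mxE !eqxx addr0 expr1n sqrtr1.
    by rewrite !mxE (negbTE ki) expr0n.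
  have uAu : (u^T *m A *m u) 0 0 = lam 0 i.
    rewrite AE /u trmx_mul trmx_delta !mulmxA -(mulmxA _ U^T) UU mulmx1.
    rewrite -(mulmxA _ U^T) UU mulmx1 -rowE row_diag_mx.
    by rewrite -scalemxAl mul_delta_mx !mxE !eqxx mulr1.
  have uASu : (u^T *m (A - S) *m u) 0 0 <= lam 0 i.
    rewrite mulmxBr mulmxBl mxE uAu gerDl mxE oppr_le0.
    exact: psdS.
  have : (- (u^T *m (A - S) *m u) 0 0) ^+ 2 <= rho ^+ 2.
    rewrite sqrrN -mulmxA mxE.
    apply: le_trans (cauchy_schwarz_sum _ _) _.
    under eq_bigr do rewrite mxE.
    rewrite -!vnorm2_sqr u1 expr1n mul1r.
    by rewrite ler_pXn2r ?nnegrE ?vnorm2_ge0// vnorm2_mulmx_le_spec.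
  move: uASu; set q := (X in X <= _) => uASu q2.
  rewrite leNgt; apply/negP => rho_lt.
  have : rho < - q by lra.
  by rewrite ltNge => /negP; apply; rewrite -(@ler_pXn2r _ 2) ?nnegrE//; lra.
have UU' : U *m U^T = 1%:M by exact: mulmx1C.
apply: spec_norm_le => //; first by rewrite mulr_ge0.
move=> v v1.
have -> : (B - S) *m v = (B - A) *m v + (A - S) *m v.
  by rewrite -mulmxDl addrA subrK.
have BAv : vnorm2 ((B - A) *m v) ^+ 2 <= rho ^+ 2.
  (* In the eigenbasis [B - A] is diagonal with entries the negative parts of the eigenvalues, each
     in [[0, rho]] by [lam_ge]. *)
  have -> : (B - A) *m v =
      U *m (diag_mx (\row_i Num.max (- lam 0 i) 0) *m (U^T *m v)).
    rewrite AE BE -mulmxBl -mulmxBr -[_ - diag_mx lam]raddfB/= !mulmxA.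
    congr (_ *m diag_mx _ *m _ *m _); apply/rowP => i; rewrite !mxE.
    by rewrite /Num.max; do 2 case: ifPn => //; lra.
  rewrite vnorm2_orthogonal// vnorm2_sqr.
  apply: (@le_trans _ _ (\sum_k rho ^+ 2 * (U^T *m v) k 0 ^+ 2)).
    apply: ler_sum => k _; rewrite mul_diag_mx mxE exprMn ler_wpM2r ?sqr_ge0//.
    have m0 : 0 <= Num.max (- lam 0 k) 0 by rewrite le_max lexx orbT.
    by rewrite mxE ler_pXn2r ?nnegrE// ge_max lam_ge.
  rewrite -mulr_sumr -vnorm2_sqr vnorm2_orthogonal ?trmxK// v1.
  by rewrite expr1n mulr1.
have ASv : vnorm2 ((A - S) *m v) ^+ 2 <= rho ^+ 2.
  by rewrite ler_pXn2r ?nnegrE ?vnorm2_ge0// vnorm2_mulmx_le_spec.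
(* [(a + b)^2 <= 2 a^2 + 2 b^2] entrywise stands in for the triangle inequality; it loses nothing
   here, both norms being bounded by the same [rho]. *)
apply: (@le_trans _ _ (2 * vnorm2 ((B - A) *m v) ^+ 2 +
    2 * vnorm2 ((A - S) *m v) ^+ 2)); last by lra.
rewrite !vnorm2_sqr !mulr_sumr -big_split/=; apply: ler_sum => k _.
rewrite [X in X ^+ 2]mxE; set a := ((B - A) *m v) k 0; set b := ((A - S) *m v) k 0.
by have := sqr_ge0 (a - b); nra.
Qed.

(** * Comparison of integrals without measurability of the smaller function *)

(* [f] need not be measurable: the integral of a nonnegative function is a
   supremum over the simple functions below it. *)
Lemma ge0_le_integral_nonmeasurable {d} {T : measurableType d} {R : realType}
    (mu : {measure set T -> \bar R}) (f g : T -> \bar R) :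
  (forall w, 0 <= f w)%E -> (forall w, f w <= g w)%E ->
  (\int[mu]_w f w <= \int[mu]_w g w)%E.
Proof.
move=> f0 fg; rewrite !ge0_integralTE//; last first.
  by move=> w; exact: le_trans (fg w).
apply: le_ereal_sup => _ [h hf <-]; exists h => // w.
exact: le_trans (hf w) (fg w).
Qed.

(** The squared spectral norms of the theorem enter as [f], so their measurability never has to be
    established. *)
Lemma ae_le_integral_nonmeasurable {d} {T : measurableType d} {R : realType}
    (mu : {measure set T -> \bar R}) (f g : T -> \bar R) :
  (forall w, 0 <= f w)%E -> (forall w, 0 <= g w)%E ->
  measurable_fun setT g -> {ae mu, forall w, (f w <= g w)%E} ->
  (\int[mu]_w f w <= \int[mu]_w g w)%E.
Proof.
move=> f0 g0 mg [N [mN N0 fgN]].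
(* Raising [g] to [+oo] on the null set [N] makes it dominate [f] everywhere and leaves its integral
   unchanged; off [N] the added term is [+oo * 0 = 0]. *)
pose h w := (g w + +oo * (\1_N w)%:E)%E.
have mh : measurable_fun setT h.
  by apply: emeasurable_funD => //; apply: measurable_funeM;
     apply/measurable_EFinP; exact: measurable_indic.
have h0 w : (0 <= h w)%E by rewrite adde_ge0// mule_ge0 ?leey// lee_fin.
have -> : (\int[mu]_w g w = \int[mu]_w h w)%E.
  apply: ge0_ae_eq_integral => //; exists N; split => // w /=.
  move=> gh; apply: contrapT => Nw; apply: gh => _.
  by rewrite /h indicE memNset// mule0 adde0.
apply: ge0_le_integral_nonmeasurable => // w; rewrite /h indicE.
have [Nw|/negP Nw] := boolP (w \in N).
  by rewrite mule1 addey ?leey// gt_eqF// (lt_le_trans _ (g0 w)).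
rewrite mule0 adde0; apply: contrapT => fgw.
by apply: Nw; rewrite inE; apply: fgN.
Qed.

(** * An exponential moment of the Gaussian noise *)

(** The change of variables is stated for the abstract Radon-Nikodym derivative; it agrees almost
    everywhere with [normal_pdf] because both have the same integral over every measurable set. *)
Lemma ge0_integral_normal_prob {R : realType} (m s : R) (f : R -> \bar R) :
  (forall y, 0 <= f y)%E -> measurable_fun setT f ->
  (\int[normal_prob m s]_y f y =
   \int[lebesgue_measure]_y (f y * (normal_pdf m s y)%:E))%E.
Proof.
move=> f0 mf.
have dom : normal_prob m s `<< lebesgue_measure by exact: normal_prob_dominates.
rewrite -(Radon_Nikodym_SigmaFinite.change_of_variables dom)//.
have mpdf : measurable_fun [set: R] (fun y => (normal_pdf m s y)%:E).
  by apply/measurable_EFinP; exact: measurable_normal_pdf.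
have intf := Radon_Nikodym_SigmaFinite.f_integrable dom.
apply: ae_eq_integral => //.
- by apply: emeasurable_funM => //; exact: measurable_int intf.
- exact: emeasurable_funM.
- apply: ae_eqe_mul2l; apply: integral_ae_eq => //= E _ mE.
  by rewrite -Radon_Nikodym_SigmaFinite.f_integral.
Qed.

(** Since [15/32 - 1/2 = -1/32], the weight turns the density of [N(0, s^2)] into 4 times that of
    [N(0, (4 s)^2)]. *)
Lemma integral_normal_prob_expR_sqr {R : realType} (s : R) : 0 < s ->
  (\int[normal_prob 0 s]_y (expR (15 / 32 * (y / s) ^+ 2))%:E = 4%:E)%E.
Proof.
move=> s0; rewrite ge0_integral_normal_prob.
- have s_neq0 : s != 0 by rewrite gt_eqF.
  transitivity (\int[lebesgue_measure]_y (4%:E * (normal_pdf 0 (4 * s) y)%:E))%E.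
    apply: eq_integral => y _.
    rewrite -EFinM -EFinM; congr EFin.
    rewrite !normal_pdfE ?mulf_neq0// /normal_peak /normal_fun.
    rewrite mulrCA -expRD [RHS]mulrA; congr (_ * expR _); last by field.
    have -> : (4 * s) ^+ 2 * pi *+ 2 = 4 ^+ 2 * (s ^+ 2 * pi *+ 2) by ring.
    rewrite [in RHS]sqrtrM ?sqr_ge0// sqrtr_sqr ger0_norm//.
    by rewrite invfM mulrA divff ?mul1r.
  rewrite ge0_integralZl//.
  + by rewrite integral_normal_pdf mule1.
  + by apply/measurable_EFinP; exact: measurable_normal_pdf.
  + by move=> y _; rewrite lee_fin normal_pdf_ge0.
- by move=> y; rewrite lee_fin expR_ge0.
- apply/measurable_EFinP; apply: measurableT_comp => //.
  by apply: measurable_funM => //; apply: measurable_funX; exact: measurable_funM.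
Qed.

Lemma integral_expR_sqr_normal {d} {T : measurableType d} {R : realType}
    (P : probability T R) (Z : T -> R) (s : R) : 0 < s ->
  measurable_fun setT Z ->
  (forall B, measurable B -> P (Z @^-1` B) = normal_prob 0 s B) ->
  (\int[P]_w (expR (15 / 32 * (Z w / s) ^+ 2))%:E = 4%:E)%E.
Proof.
move=> s0 mZ lawZ; rewrite -(integral_normal_prob_expR_sqr _ s0).
(* [normal_prob] lives on [measurableTypeR R], whose display differs from the
   one of the measurable structure inferred for [R]. *)
pose Z' : T -> measurableTypeR R := Z.
pose f (y : measurableTypeR R) := (expR (15 / 32 * (y / s) ^+ 2))%:E.
have mf : measurable_fun setT f.
  apply/measurable_EFinP; apply: measurableT_comp => //.
  by apply: measurable_funM => //; apply: measurable_funX; exact: measurable_funM.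
have mZ' : measurable_fun setT Z' by exact: mZ.
transitivity (\int[pushforward P Z']_y f y)%E.
  by rewrite ge0_integral_pushforward// => y _; rewrite lee_fin expR_ge0.
pose pZ : {measure set (measurableTypeR R) -> \bar R} := pushforward P Z'.
apply: (@eq_measure_integral _ _ _ setT (normal_prob 0 s) (pZ mZ')).
by move=> B mB _; exact: lawZ.
Qed.

(** * The union bound in integrated form *)

(** Here [c0] is the loss on the good event, [A i] the event that the data are bad at entry [i], and
    [W i] the exponential weight of the noise there. Only the marginal laws of the entries matter,
    by linearity. *)
Lemma integral_le_indic_sum {d} {T : measurableType d} {R : realType}
    (P : probability T R) (I : finType) (A : I -> set T) (W : I -> T -> R)
    (f : T -> R) (c0 c1 c2 q m : R) :
  0 <= c0 -> 0 <= c1 -> 0 <= c2 -> (forall w, 0 <= f w) ->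
  (forall i, measurable (A i)) -> (forall i, measurable_fun setT (W i)) ->
  (forall i w, 0 <= W i w) ->
  (forall i, P (A i) <= q%:E)%E -> (forall i, \int[P]_w (W i w)%:E = m%:E)%E ->
  {ae P, forall w, f w <= c0 + \sum_i (c1 * \1_(A i) w + c2 * W i w)} ->
  (\int[P]_w (f w)%:E <= (c0 + #|I|%:R * (c1 * q + c2 * m))%:E)%E.
Proof.
move=> c00 c10 c20 f0 mA mW W0 PA IW fle.
have mi i : measurable_fun setT (fun w => (\1_(A i) w)%:E : \bar R).
  by apply/measurable_EFinP; exact: measurable_indic.
have mWE i : measurable_fun setT (fun w => (W i w)%:E) by exact/measurable_EFinP.
have m1 i : measurable_fun setT (fun w => c1%:E * (\1_(A i) w)%:E)%E.
  exact: measurable_funeM.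
have m2 i : measurable_fun setT (fun w => c2%:E * (W i w)%:E)%E.
  exact: measurable_funeM.
have g1 i w : (0 <= c1%:E * (\1_(A i) w)%:E)%E by rewrite mule_ge0.
have g2 i w : (0 <= c2%:E * (W i w)%:E)%E by rewrite mule_ge0 ?lee_fin.
pose g w := (c0%:E + \sum_i (c1%:E * (\1_(A i) w)%:E + c2%:E * (W i w)%:E))%E.
have gE w : g w = (c0 + \sum_i (c1 * \1_(A i) w + c2 * W i w))%:E.
  by rewrite EFinD -sumEFin.
have mg1 i : measurable_fun setT
    (fun w => c1%:E * (\1_(A i) w)%:E + c2%:E * (W i w)%:E)%E.
  exact: emeasurable_funD.
have g12 i w : (0 <= c1%:E * (\1_(A i) w)%:E + c2%:E * (W i w)%:E)%E.
  exact: adde_ge0.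
have ms : measurable_fun setT
    (fun w => \sum_i (c1%:E * (\1_(A i) w)%:E + c2%:E * (W i w)%:E))%E.
  exact: emeasurable_sum.
have s0 w : (0 <= \sum_i (c1%:E * (\1_(A i) w)%:E + c2%:E * (W i w)%:E))%E.
  exact: sume_ge0.
apply: (@le_trans _ _ (\int[P]_w g w)%E).
  apply: ae_le_integral_nonmeasurable.
  - by move=> w; rewrite lee_fin.
  - by move=> w; rewrite adde_ge0.
  - exact: emeasurable_funD.
  - by apply: filterS fle => w; rewrite gE lee_fin.
have I0 : (\int[P]_w c0%:E = c0%:E)%E.
  by rewrite integral_cst//= probability_setT mule1.
rewrite ge0_integralD// I0 EFinD leeD2l//.
rewrite ge0_integral_sum//.
rewrite (_ : (#|I|%:R * _)%:E = \sum_(i : I) (c1 * q + c2 * m)%:E)%E; last first.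
  by rewrite sumEFin sumr_const mulr_natl.
apply: lee_sum => i _.
rewrite ge0_integralD//.
rewrite (ge0_integralZl _ measurableT (mi i))//.
rewrite (ge0_integralZl _ measurableT (mWE i))//.
rewrite IW integral_indic// setIT EFinD leeD2r// EFinM.
  by apply: lee_wpmul2l; [rewrite lee_fin|exact: PA].
by move=> w _; rewrite lee_fin.
Qed.

(** * Bounded samples and their second moments *)

Lemma abs_mul_le1 {R : realType} p (x : 'I_p -> R) a b :
  \sum_k x k ^+ 2 <= 1 -> `|x a * x b| <= 1.
Proof.
have le_sum c : x c ^+ 2 <= \sum_k x k ^+ 2.
  by rewrite (bigD1 c)//= lerDl sumr_ge0// => k _; exact: sqr_ge0.
move=> x1; have := le_trans (le_sum a) x1; have := le_trans (le_sum b) x1.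
rewrite normrM -(real_normK (num_real (x a))) -(real_normK (num_real (x b))).
by have := sqr_ge0 (`|x a| - `|x b|); nra.
Qed.

Lemma sample_cov_le1 {R : realType} n p (x : 'I_n -> 'I_p -> R) a b :
  (0 < n)%N -> (forall i, \sum_k x i k ^+ 2 <= 1) -> `|sample_cov x a b| <= 1.
Proof.
move=> n0 x1; rewrite mxE normrM ger0_norm ?invr_ge0//.
rewrite ler_pdivrMl ?ltr0n// mulr1.
apply: le_trans (ler_norm_sum _ _ _) _.
rewrite -[n in leRHS]card_ord -sum1_card natr_sum.
by apply: ler_sum => i _; exact: abs_mul_le1.
Qed.

Section second_moment.
Context {d} {T : measurableType d} {R : realType} (P : probability T R).
Context (p : nat) (X : T -> 'I_p -> R) (S : 'M[R]_p).
Hypothesis mX : forall k, measurable_fun setT (X ^~ k).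
Hypothesis X1 : {ae P, forall w, \sum_k X w k ^+ 2 <= 1}.
Hypothesis SE : forall a b, (\int[P]_w (X w a * X w b)%:E = (S a b)%:E)%E.

Let mXX a b : measurable_fun setT (fun w => (X w a * X w b)%:E).
Proof. by apply/measurable_EFinP; exact: measurable_funM. Qed.

Let int_absXX a b : (\int[P]_w `|(X w a * X w b)%:E| <= 1)%E.
Proof.
rewrite -[leRHS](_ : \int[P]_w 1 = _)%E; last first.
  by rewrite integral_cst//= mul1e probability_setT.
apply: ae_le_integral_nonmeasurable => //.
by apply: filterS X1 => w Xw; rewrite lee_fin; exact: abs_mul_le1.
Qed.

Let integrableXX a b : P.-integrable setT (fun w => (X w a * X w b)%:E).
Proof.
apply/integrableP; split => //.
exact: le_lt_trans (int_absXX a b) (ltry _).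
Qed.

Lemma second_moment_sym a b : S a b = S b a.
Proof.
apply: EFin_inj; rewrite -!SE; apply: eq_integral => w _; by rewrite mulrC.
Qed.

Lemma second_moment_le1 a b : `|S a b| <= 1.
Proof.
rewrite -lee_fin -abse_EFin -SE.
exact: le_trans (le_abse_integral _ measurableT (mXX a b)) (int_absXX a b).
Qed.

(** The quadratic form is the expectation of the square of the inner product of [v] and [X]; the
    almost sure bound on [X] gives the integrability that linearity requires. *)
Lemma second_moment_psd (v : 'cV[R]_p) : 0 <= (v^T *m S *m v) 0 0.
Proof.
have -> : (v^T *m S *m v) 0 0 = \sum_(i : 'I_p * 'I_p) v i.1 0 * v i.2 0 * S i.1 i.2.
  rewrite -(pair_bigA _ (fun a b => v a 0 * v b 0 * S a b)) exchange_big/= mxE.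
  apply: eq_bigr => b _; rewrite mxE mulr_suml; apply: eq_bigr => a _.
  by rewrite mxE; ring.
rewrite -lee_fin -sumEFin.
under eq_bigr => i _.
  rewrite EFinM -SE -integralZl//.
  over.
rewrite -integral_sum//=; last by move=> i; exact: integrableZl.
apply: integral_ge0 => w _.
under eq_bigr => i _ do rewrite -EFinM.
rewrite sumEFin lee_fin.
rewrite -(pair_bigA _ (fun a b => v a 0 * v b 0 * (X w a * X w b)))/=.
rewrite (_ : \sum_a _ = (\sum_a v a 0 * X w a) ^+ 2) ?sqr_ge0//.
rewrite expr2 mulr_suml; apply: eq_bigr => a _; rewrite mulr_sumr.
by apply: eq_bigr => b _; ring.
Qed.

End second_moment.

(** * Error of hard thresholding for fixed data and noise *)

Lemma sample_cov_sym {R : realType} n p (x : 'I_n -> 'I_p -> R) a b :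
  sample_cov x a b = sample_cov x b a.
Proof. by rewrite !mxE; congr (_ * _); apply: eq_bigr => i _; rewrite mulrC. Qed.

Lemma sym_noise_sym {R : realType} p (z : 'I_p -> 'I_p -> R) a b :
  sym_noise z a b = sym_noise z b a.
Proof. by rewrite !mxE; case: (ltngtP a b) => // /val_inj ->. Qed.

(** If [s = 0] then [|y| <= tau] and [y] is cut. Otherwise a kept [y] errs by at most [tau], and a
    cut one by [|s| <= |y| + |y - s|]. *)
Lemma hard_threshold_error {R : realType} (tau y s : R) : `|y - s| <= tau ->
  `|(if tau < `|y| then y else 0) - s| <= (if s == 0 then 0 else 2 * tau).
Proof.
move=> ys; have tau0 : 0 <= tau by exact: le_trans ys.
have [s0|s_neq0] := eqVneq s 0.
  by move: ys; rewrite s0 subr0 ltNge => -> /=; rewrite subr0 normr0.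
case: ltP => [_|ytau]; first by rewrite (le_trans ys)//; lra.
rewrite sub0r normrN (_ : s = y - (y - s)); last by ring.
by apply: le_trans (ler_normB _ _) _; lra.
Qed.

Lemma spec_norm_threshold_le {R : realType} n p s (tau : R)
    (x : 'I_n -> 'I_p -> R) (z : 'I_p -> 'I_p -> R) (S : 'M[R]_p) :
  (0 < p)%N -> (0 < s)%N -> in_G0 s S -> (forall a b, S a b = S b a) ->
  0 <= tau ->
  (forall a b, `|sample_cov x a b + sym_noise z a b - S a b| <= tau) ->
  spec_norm (dp_threshold tau x z - S) <= 4 * s%:R * tau.
Proof.
move=> p0 s0 GS symS tau0 close.
have entryE a b : (dp_threshold tau x z - S) a b =
    (if tau < `|sample_cov x a b + sym_noise z a b|
     then sample_cov x a b + sym_noise z a b else 0) - S a b.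
  by rewrite !mxE.
apply: spec_norm_le_col_sum => //; first by rewrite !mulr_ge0.
  by move=> a b; rewrite !entryE sample_cov_sym sym_noise_sym symS.
move=> j; apply: (@le_trans _ _ (\sum_(i | S i j != 0) 2 * tau)).
  rewrite [leRHS]big_mkcond/=; apply: ler_sum => i _; rewrite entryE.
  by apply: le_trans (hard_threshold_error _ _ _ (close i j)) _; case: eqP.
rewrite sumr_const -[leLHS]mulr_natl.
(* [in_G0] counts off-diagonal entries only, so the diagonal adds one; [1 + s <= 2 s] then gives the
   factor 4 in [4 s tau]. *)
have card_le : (#|[pred i | S i j != 0%R]| <= 1 + s)%N.
  have GSj : (#|[pred i | (i != j) && (S i j != 0%R)]| <= s)%N.
    apply: leq_trans (GS j); apply/subset_leq_card/fintype.subsetP => i.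
    by rewrite inE => ij; apply: mem_set.
  apply: leq_trans (leq_add (leqnn 1) GSj).
  rewrite -(card1 j) -cardUI; apply: leq_trans (leq_addr _ _).
  apply/subset_leq_card/fintype.subsetP => i; rewrite !inE => ->.
  by rewrite andbT orbN.
have card_le2 : (#|[pred i | S i j != 0%R]|%:R : R) <= 2 * s%:R.
  rewrite -natrM ler_nat (leq_trans card_le)// mul2n -addnn leq_add2r//.
rewrite (_ : 4 * s%:R * tau = 2 * s%:R * (2 * tau)); last by ring.
by rewrite ler_wpM2r// mulr_ge0.
Qed.

(** The product [u^2 c] is split by the inequality of means into [c^2] and a multiple of [u^4], and
    the quadratic Taylor term of the exponential dominates the latter. A large [c] makes the
    coefficient of the exponential small. *)
Lemma sqr_le_expR_sqr {R : realType} (u c : R) : 0 < c ->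
  u ^+ 2 <= c + 10 / c * expR (15 / 32 * u ^+ 2).
Proof.
move=> c0; set y := 15 / 32 * u ^+ 2.
have y0 : 0 <= y by rewrite mulr_ge0// sqr_ge0.
have /= := expR_ge1Dxn 1 y0; rewrite (_ : 2`!%:R = 2)// => ye.
have : u ^+ 2 * c <= c ^+ 2 + 10 * expR y.
  have -> : u ^+ 2 = 32 / 15 * y by rewrite /y; lra.
  by have := sqr_ge0 (c - 16 / 15 * y); have := sqr_ge0 y; lra.
move=> h; rewrite -(ler_pM2r c0) mulrDl -expr2.
by rewrite (_ : 10 / c * expR y * c = 10 * expR y)//; field; rewrite gt_eqF.
Qed.

Lemma hard_threshold_sqr_error_le {R : realType} (tau y z s : R) :
  `|y| <= 1 -> `|s| <= 1 ->
  ((if tau < `|y + z| then y + z else 0) - s) ^+ 2 <= 8 + 2 * z ^+ 2.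
Proof.
rewrite !ler_norml => /andP[y1 y2] /andP[s1 s2].
case: ifP => _; last by have := sqr_ge0 z; nra.
by have := sqr_ge0 (y - s - z); nra.
Qed.

(** The threshold contributes [15/32 * 4^2 = 15/2] to the exponent, which is rounded down to 7. *)
Lemma expR_sqr_ge_expn {R : realType} (p : nat) (s y : R) : (0 < p)%N ->
  0 < s -> 4 * s * Num.sqrt (ln p%:R) < `|y| ->
  (p%:R : R) ^+ 7 <= expR (15 / 32 * (y / s) ^+ 2).
Proof.
move=> p0 s0 ylt; have lnp0 : 0 <= ln (p%:R : R) by rewrite ln_ge0// ler1n.
rewrite -[X in X ^+ 7](@lnK R) ?posrE ?ltr0n// -expRM_natl ler_expR.
have us : 4 * Num.sqrt (ln p%:R) < `|y / s|.
  rewrite normrM (gtr0_norm (x := s^-1)) ?invr_gt0// ltr_pdivlMr//.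
  by rewrite mulrAC.
have : (4 * Num.sqrt (ln p%:R)) ^+ 2 <= (y / s) ^+ 2.
  rewrite -(real_normK (num_real (y / s))) ler_pXn2r ?nnegrE ?mulr_ge0 ?sqrtr_ge0//.
  exact: ltW.
rewrite exprMn sqr_sqrtr//; lra.
Qed.

(* The indicator of the bad event is at most the sum over the entries of
   [bad + W / p ^ 7]; [c1] is its weight in the Frobenius bound, and the last
   summand of [c2] comes from [u ^+ 2 <= p ^ 3 + 10 / p ^ 3 * W]. *)
Lemma spec_norm_threshold_sqr_le {R : realType} n p s (t sg : R)
    (x : 'I_n -> 'I_p -> R) (z : 'I_p -> 'I_p -> R) (S : 'M[R]_p) :
  let tau := t + 4 * sg * Num.sqrt (ln p%:R) in
  let c1 := 8 * p%:R ^+ 2 + 2 * sg ^+ 2 * p%:R ^+ 5 in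
  let c2 := c1 / p%:R ^+ 7 + 20 * sg ^+ 2 / p%:R ^+ 3 in
  (0 < n)%N -> (0 < p)%N -> (0 < s)%N -> 0 <= t -> 0 < sg ->
  in_G0 s S -> (forall a b, S a b = S b a) -> (forall a b, `|S a b| <= 1) ->
  (forall i, \sum_k x i k ^+ 2 <= 1) ->
  spec_norm (dp_threshold tau x z - S) ^+ 2 <=
  (4 * s%:R * tau) ^+ 2 + \sum_(i : 'I_p * 'I_p)
    (c1 * (t < `|sample_cov x i.1 i.2 - S i.1 i.2|)%R%:R +
     c2 * expR (15 / 32 * (sym_noise z i.1 i.2 / sg) ^+ 2)).
Proof.
move=> tau c1 c2 n0 p0 s0 t0 sg0 GS symS S1 x1.
have P0 : 0 < (p%:R : R) by rewrite ltr0n.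
have c10 : 0 <= c1.
  by rewrite addr_ge0// !mulr_ge0// ?exprn_ge0// ltW.
have d0 : 0 <= 20 * sg ^+ 2 / p%:R ^+ 3.
  by rewrite !mulr_ge0// ?invr_ge0 ?exprn_ge0// ltW.
have c20 : 0 <= c2 by rewrite addr_ge0// divr_ge0// exprn_ge0.
have tau0 : 0 <= tau by rewrite addr_ge0// !mulr_ge0 ?sqrtr_ge0// ltW.
pose bad (i : 'I_p * 'I_p) := t < `|sample_cov x i.1 i.2 - S i.1 i.2|.
pose W (i : 'I_p * 'I_p) := expR (15 / 32 * (sym_noise z i.1 i.2 / sg) ^+ 2).
have W0 i : 0 <= W i by exact: expR_ge0.
rewrite -/bad -/W.
have term0 i : 0 <= c1 * (bad i)%:R + c2 * W i.
  by rewrite addr_ge0// mulr_ge0.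
have [/forallP good|] := boolP [forall i : 'I_p * 'I_p, ~~ bad i &&
    (`|sym_noise z i.1 i.2| <= 4 * sg * Num.sqrt (ln p%:R))].
  apply: ler_wpDr; first by apply: sumr_ge0 => i _; exact: term0.
  have B0 : 0 <= 4 * s%:R * tau by rewrite !mulr_ge0.
  rewrite ler_pXn2r ?nnegrE ?spec_norm_ge0//.
  apply: spec_norm_threshold_le => // a b.
  have /andP[/=] := good (a, b); rewrite -leNgt /= => h1 h2.
  rewrite addrAC; apply: le_trans (ler_normD _ _) _.
  exact: lerD.
rewrite negb_forall => /existsP[j badj].
have Q1 : 1 <= \sum_i ((bad i)%:R + W i / p%:R ^+ 7).
  have Q0 i : 0 <= (bad i)%:R + W i / p%:R ^+ 7.
    by rewrite addr_ge0// divr_ge0// exprn_ge0.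
  rewrite (bigD1 j)//=; apply: ler_wpDr; first by apply: sumr_ge0.
  move: badj; rewrite negb_and negbK => /orP[->|].
    by rewrite lerDl divr_ge0// exprn_ge0.
  rewrite -ltNge => /(expR_sqr_ge_expn _ _ _ p0 sg0) Wj.
  by apply: ler_wpDl => //; rewrite ler_pdivlMr ?exprn_gt0// mul1r.
apply: ler_wpDl; first exact: sqr_ge0.
apply: le_trans (spec_norm_sqr_le_frobenius _ _ p0) _; rewrite pair_bigA/=.
(* [c1 / p^2 = 8 + 2 sg^2 p^3] is the entrywise bound [8 + 2 z^2] after [(z / sg)^2] is truncated at
   [p^3]; summed over the [p^2] entries it gives [c1]. *)
apply: (@le_trans _ _ (\sum_(i : 'I_p * 'I_p) (c1 / p%:R ^+ 2 +
    20 * sg ^+ 2 / p%:R ^+ 3 * W i))).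
  apply: ler_sum => i _; rewrite !mxE.
  have cov1 : `|sample_cov x i.1 i.2| <= 1 by exact: sample_cov_le1.
  have := hard_threshold_sqr_error_le tau _ (sym_noise z i.1 i.2) _ cov1 (S1 i.1 i.2).
  rewrite !mxE => /le_trans; apply.
  set y : R := if _ then _ else _.
  have yE : y = sym_noise z i.1 i.2 by rewrite mxE.
  have P3 : 0 < (p%:R : R) ^+ 3 by rewrite exprn_gt0.
  have := sqr_le_expR_sqr (y / sg) _ P3; rewrite [X in expR (_ * (X / _) ^+ _)]yE -/(W i).
  have -> : y ^+ 2 = sg ^+ 2 * (y / sg) ^+ 2 by field; rewrite gt_eqF.
  have -> : c1 / p%:R ^+ 2 = 8 + 2 * sg ^+ 2 * p%:R ^+ 3.
    by rewrite /c1; field; rewrite gt_eqF.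
  move=> /(ler_wpM2l (sqr_ge0 sg)) h.
  rewrite (_ : 20 * _ / _ * _ = 2 * (sg ^+ 2 * (10 / p%:R ^+ 3 * W i))); last ring.
  lra.
rewrite big_split/= sumr_const card_prod card_ord.
rewrite (_ : c1 / p%:R ^+ 2 *+ (p * p) = c1); last first.
  by rewrite -mulr_natr natrM; field; rewrite gt_eqF.
(* [Q1] charges the constant [c1] to the bad event, whose expected weight is small. *)
apply: (@le_trans _ _ (c1 * \sum_i ((bad i)%:R + W i / p%:R ^+ 7) +
    \sum_i 20 * sg ^+ 2 / p%:R ^+ 3 * W i)).
  by rewrite lerD2r ler_peMr.
rewrite mulr_sumr -big_split/=; apply: ler_sum => i _.
by rewrite le_eqVlt; apply/orP; left; apply/eqP; rewrite /c2 -/(bad i) -/(W i); ring.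
Qed.

(** * Comparison of the risk bound with the rate *)

Lemma risk_bound_le_rate {R : realType} (gamma l C1 eps L N P lp s sg t : R) :
  let tau := t + 4 * sg * Num.sqrt lp in
  let c1 := 8 * P ^+ 2 + 2 * sg ^+ 2 * P ^+ 5 in
  let c2 := c1 / P ^+ 7 + 20 * sg ^+ 2 / P ^+ 3 in
  0 < gamma -> 0 < l -> l <= L -> 0 < C1 -> 0 < eps -> eps <= 1 ->
  1 <= lp -> 1 <= N -> N <= P -> 1 <= s ->
  sg ^+ 2 = 2 * L / (N * eps) ^+ 2 -> t ^+ 2 = gamma ^+ 2 * lp / N ->
  (4 * s * tau) ^+ 2 + (P * P) * (c1 * (C1 / P ^+ 8) + c2 * 4) <=
  (16 * (2 * gamma ^+ 2 / l + 64) + (C1 + 4) * (8 / l + 4) + 160) *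
  (s ^+ 2 * lp * L / (N * eps ^+ 2)).
Proof.
move=> tau c1 c2 g0 l0 lL C10 e0 e1 lp1 N1 NP s1 sgE tE.
have N0 : 0 < N by lra.
have P0 : 0 < P by lra.
have L0 : 0 < L by lra.
set X := L / (N * eps ^+ 2).
have X0 : 0 < X by rewrite divr_gt0// mulr_gt0// exprn_gt0.
have sgX : sg ^+ 2 <= 2 * X.
  have h : ((N * eps) ^+ 2)^-1 <= (N * eps ^+ 2)^-1.
    rewrite lef_pV2 ?posrE ?exprn_gt0 ?mulr_gt0// ?exprn_gt0//.
    by rewrite exprMn ler_wpM2r ?sqr_ge0// expr2 ler_peMr// ltW.
  by rewrite sgE /X -mulrA ler_wpM2l// ler_wpM2l// ltW.
(* The sampling error has no privacy factor; it is absorbed into the rate because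
   [L / eps^2 >= l]. *)
have NX : N^-1 <= X / l.
  rewrite ler_pdivlMr// (_ : X = N^-1 * (L / eps ^+ 2)); last first.
    by rewrite /X; field; rewrite !gt_eqF.
  rewrite ler_wpM2l ?invr_ge0 ?(ltW N0)// (le_trans lL)//.
  by rewrite ler_peMr ?(ltW L0)// invf_ge1 ?exprn_gt0// exprn_ile1// ltW.
have tauX : tau ^+ 2 <= (2 * gamma ^+ 2 / l + 64) * (lp * X).
  have t2X : t ^+ 2 <= gamma ^+ 2 * lp * (X / l).
    by rewrite tE ler_wpM2l// mulr_ge0 ?sqr_ge0//; lra.
  have sq : (4 * sg * Num.sqrt lp) ^+ 2 = 16 * sg ^+ 2 * lp.
    by rewrite !exprMn sqr_sqrtr; [ring|lra].
  apply: (@le_trans _ _ (2 * t ^+ 2 + 2 * (4 * sg * Num.sqrt lp) ^+ 2)).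
    by rewrite /tau; set b := 4 * sg * _; have := sqr_ge0 (t - b); lra.
  have : sg ^+ 2 * lp <= 2 * X * lp by rewrite ler_wpM2r//; lra.
  rewrite sq (_ : (_ + 64) * _ =
    2 * (gamma ^+ 2 * lp * (X / l)) + 64 * (X * lp)); last by field; rewrite gt_eqF.
  lra.
have tailX : P * P * (c1 * (C1 / P ^+ 8) + c2 * 4) <=
    ((C1 + 4) * (8 / l + 4) + 160) * X.
  have P1 : 1 <= P by lra.
  have Pk k : P ^- k.+1 <= P^-1.
    by rewrite lef_pV2 ?posrE ?exprn_gt0// exprS ler_peMr ?(ltW P0)// exprn_ege1.
  have Pi1 : P^-1 <= 1 by rewrite invf_le1.
  have PiX : P^-1 <= X / l by apply: le_trans NX; rewrite lef_pV2 ?posrE.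
  have sg20 : 0 <= sg ^+ 2 by exact: sqr_ge0.
  (* The power 7 just suffices: [P^2 * 2 sg^2 P^5 / P^7] carries no [P]. What remains is [sg^2], at
     most [2 X], or a negative power of [P], at most [1 / N]. *)
  have -> : P * P * (c1 * (C1 / P ^+ 8) + c2 * 4) =
      C1 * (8 * P ^- 4 + 2 * sg ^+ 2 * P^-1) +
      4 * (8 * P ^- 3 + 2 * sg ^+ 2) + 80 * sg ^+ 2 * P^-1.
    by rewrite /c2 /c1; field; rewrite gt_eqF.
  have sP : sg ^+ 2 * P^-1 <= 2 * X.
    by apply: le_trans sgX; rewrite ler_piMr.
  have h1 : C1 * (8 * P ^- 4 + 2 * sg ^+ 2 * P^-1) <= C1 * (8 * (X / l) + 4 * X).
    rewrite ler_wpM2l ?(ltW C10)//; have := Pk 3; lra.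
  have h2 : P ^- 3 <= X / l by exact: le_trans (Pk 2) PiX.
  rewrite (_ : (_ + 160) * X = C1 * (8 * (X / l) + 4 * X) +
    4 * (8 * (X / l) + 4 * X) + 160 * X); last by field; rewrite gt_eqF.
  lra.
have s21 : 1 <= s ^+ 2 by exact: exprn_ege1.
have Xle : X <= s ^+ 2 * lp * X.
  rewrite ler_peMl ?(ltW X0)//; nra.
rewrite (_ : s ^+ 2 * lp * L / _ = s ^+ 2 * lp * X); last by rewrite /X mulrA.
have k0 : 0 <= (C1 + 4) * (8 / l + 4) + 160.
  by rewrite addr_ge0// mulr_ge0// addr_ge0// ?divr_ge0// ltW.
have := ler_wpM2l k0 Xle; have := ler_wpM2l (sqr_ge0 s) tauX.
rewrite [(4 * s * tau) ^+ 2](_ : _ = 16 * (s ^+ 2 * tau ^+ 2)); last ring.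
lra.
Qed.

(** * Assembly of the two risk bounds *)

Theorem theorem2 (R : realType) (sigma2 gamma C1 t0 : R) :
  0 < sigma2 -> 0 < gamma -> 0 < C1 -> 0 < t0 ->
  exists (C : R) (K p0 : nat), 0 < C /\
  forall (d : measure_display) (T : measurableType d) (P : probability T R)
    (n p s : nat) (eps delta : R)
    (x : 'I_n -> T -> 'I_p -> R) (z : 'I_p -> 'I_p -> T -> R)
    (Sigma : 'M[R]_p) (Splus : T -> 'M[R]_p),
  (* regime p >> n >= poly(log p) *)
  (p0 <= p)%N -> (1 <= n)%N -> (n <= p)%N -> ln (p%:R : R) ^+ K <= n%:R ->
  (1 <= s)%N ->
  0 < eps <= 1 -> 0 < delta <= 1 ->
  (* data model *)
  (forall i k, measurable_fun setT (fun w => x i w k)) ->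
  (forall a b, measurable_fun setT (z a b)) ->
  dp_independent P x z ->
  ident_distrib P x ->
  (forall i k, (\int[P]_w (x i w k)%:E = 0)%E) ->
  (forall i, {ae P, forall w, \sum_(k < p) x i w k ^+ 2 <= 1}) ->
  (forall i (v : 'I_p -> R) t, \sum_(k < p) v k ^+ 2 = 1 -> 0 < t ->
     (P [set w | (t < `|\sum_(k < p) v k * x i w k|)%R]
      <= (expR (- t ^+ 2 / (2 * sigma2)))%R%:E)%E) ->
  (forall i a b, (\int[P]_w (x i w a * x i w b)%:E = (Sigma a b)%:E)%E) ->
  in_G0 s Sigma ->
  (forall a b t, 0 < t <= t0 ->
     (P [set w | (t < `|sample_cov (x ^~ w) a b - Sigma a b|)%R]
      <= (C1 * expR (- (8 * n%:R * t ^+ 2) / gamma ^+ 2))%R%:E)%E) ->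
  (* privacy noise: i.i.d. N(0, sigma_1^2) upper-triangular entries *)
  (forall a b : 'I_p, (a <= b)%N -> forall B : set R, measurable B ->
     P (z a b @^-1` B) = normal_prob 0 (dp_sigma1 n eps delta) B) ->
  (* step (3) *)
  (forall w, psd_projection
     (dp_threshold (dp_tau gamma n p eps delta) (x ^~ w) (fun a b => z a b w))
     (Splus w)) ->
  let rate := s%:R ^+ 2 * ln p%:R * ln (5 / 4 / delta) / (n%:R * eps ^+ 2) in
  (\int[P]_w ((spec_norm (dp_threshold (dp_tau gamma n p eps delta)
                 (x ^~ w) (fun a b => z a b w) - Sigma)) ^+ 2)%R%:E
     <= (C * rate)%R%:E)%E /\
  (\int[P]_w ((spec_norm (Splus w - Sigma)) ^+ 2)%R%:E <= (C * rate)%R%:E)%E.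
Proof.
move=> _ gamma0 C10 t00.
(* The value of [ln (5 / 4 / delta)] at [delta = 1], hence a positive lower bound for all admissible
   [delta]. *)
set l : R := ln (5 / 4).
have l0 : 0 < l by rewrite ln_gt0//; lra.
set C := 16 * (2 * gamma ^+ 2 / l + 64) + (C1 + 4) * (8 / l + 4) + 160.
have C0 : 0 < C.
  rewrite addr_gt0// addr_gt0// mulr_gt0// ?addr_gt0 ?divr_gt0//.
  by rewrite mulr_gt0// exprn_gt0.
(* The factor 4 is the square of the doubling by the projection. The exponent 2 and the bound on [p]
   give [ln p ^ 2 <= n] and [ln p >= 1 + gamma^2 / t0^2], whence [t^2 <= gamma^2 / ln p <= t0^2]:
   the concentration hypothesis applies at [t]. *)
exists (4 * C), 2, (Num.truncn (expR (1 + gamma ^+ 2 / t0 ^+ 2))).+1.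
split; first by rewrite mulr_gt0.
move=> d T P n p s eps delta x z Sigma Splus p0p n1 np lnpn s1.
move=> /andP[eps0 eps1] /andP[delta0 delta1] mx mz _ _ _ x1 _ SE GS covP zP SplusP.
set L := ln (5 / 4 / delta).
move=> rate.
have b0 : 0 <= gamma ^+ 2 / t0 ^+ 2 by rewrite divr_ge0 ?sqr_ge0.
have lnp : 1 + gamma ^+ 2 / t0 ^+ 2 <= ln p%:R.
  rewrite -[leLHS]expRK ler_ln ?posrE ?expR_gt0//.
    apply: le_trans (ltW (truncnS_gt _)) _; by rewrite ler_nat.
  by rewrite ltr0n (leq_trans _ p0p).
have p0 : (0 < p)%N by rewrite (leq_trans _ p0p).
have lnp1 : 1 <= ln (p%:R : R) by lra.
have lnp0 : 0 <= ln (p%:R : R) by lra.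
have n0 : 0 < (n%:R : R) by rewrite ltr0n.
have P0 : 0 < (p%:R : R) by rewrite ltr0n.
set t := gamma * Num.sqrt (ln p%:R / n%:R).
have tE : t ^+ 2 = gamma ^+ 2 * ln p%:R / n%:R.
  by rewrite exprMn sqr_sqrtr ?mulrA// divr_ge0 ?(ltW n0).
have t_gt0 : 0 < t by rewrite mulr_gt0// sqrtr_gt0 divr_gt0//; lra.
have t_le : t <= t0.
  rewrite -(@ler_pXn2r _ 2) ?nnegrE ?(ltW t_gt0) ?(ltW t00)// tE.
  rewrite ler_pdivrMr// (le_trans _ (ler_wpM2l (sqr_ge0 t0) lnpn))//.
  rewrite [ln _ ^+ 2]expr2 mulrA ler_wpM2r// -ler_pdivrMl ?exprn_gt0// mulrC.
  by apply: le_trans lnp; rewrite lerDr.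
set sg := dp_sigma1 n eps delta in zP.
have lL : l <= L.
  rewrite ler_ln ?posrE ?divr_gt0// ler_peMr//.
  by rewrite invf_ge1.
have L0 : 0 < L by exact: lt_le_trans lL.
have sg0 : 0 < sg.
  by rewrite /sg /dp_sigma1 divr_gt0 ?mulr_gt0// sqrtr_gt0 mulr_gt0.
have sgE : sg ^+ 2 = 2 * L / (n%:R * eps) ^+ 2.
  by rewrite expr_div_n sqr_sqrtr// mulr_ge0// ltW.
have tauE : dp_tau gamma n p eps delta = t + 4 * sg * Num.sqrt (ln p%:R).
  by rewrite /dp_tau /sg /dp_sigma1 -/t; ring.
clearbody sg.
pose i0 : 'I_n := Ordinal n1.
have mx0 k : measurable_fun setT (fun w => x i0 w k) by exact: mx.
have symS a b : Sigma a b = Sigma b a.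
  exact: (second_moment_sym P _ (x i0) _ (SE i0)).
have S1 a b : `|Sigma a b| <= 1.
  exact: (second_moment_le1 P _ (x i0) _ mx0 (x1 i0) (SE i0)).
have psdS (v : 'cV[R]_p) : 0 <= (v^T *m Sigma *m v) 0 0.
  exact: (second_moment_psd P _ (x i0) _ mx0 (x1 i0) (SE i0)).
pose c1 := 8 * p%:R ^+ 2 + 2 * sg ^+ 2 * p%:R ^+ 5.
pose c2 := c1 / p%:R ^+ 7 + 20 * sg ^+ 2 / p%:R ^+ 3.
have c10 : 0 <= c1.
  by rewrite addr_ge0// !mulr_ge0// ?exprn_ge0// ltW.
have c20 : 0 <= c2.
  by rewrite addr_ge0// ?divr_ge0// ?mulr_ge0// ?exprn_ge0// ltW.
pose hatS w := dp_threshold (dp_tau gamma n p eps delta) (x ^~ w)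
  (fun a b => z a b w).
pose A (i : 'I_p * 'I_p) :=
  [set w | (t < `|sample_cov (x ^~ w) i.1 i.2 - Sigma i.1 i.2|)%R].
pose W (i : 'I_p * 'I_p) w :=
  expR (15 / 32 * (sym_noise (fun a b => z a b w) i.1 i.2 / sg) ^+ 2).
pose zs (i : 'I_p * 'I_p) := if (i.1 <= i.2)%N then z i.1 i.2 else z i.2 i.1.
have zsE i w : sym_noise (fun a b => z a b w) i.1 i.2 = zs i w.
  by rewrite mxE /zs; case: ifP.
have mzs i : measurable_fun setT (zs i) by rewrite /zs; case: ifP.
have zsP i B : measurable B -> P (zs i @^-1` B) = normal_prob 0 sg B.
  rewrite /zs; case: ifP => [|/negbT]; first by move=> h; exact: zP.
  by rewrite -ltnNge => /ltnW h; exact: zP.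
have mA i : measurable (A i).
  have mg : measurable_fun setT
      (fun w => `|sample_cov (x ^~ w) i.1 i.2 - Sigma i.1 i.2|).
    apply: measurableT_comp => //; apply: measurable_funB => //.
    under eq_fun do rewrite mxE.
    apply: measurable_funM => //; apply: measurable_sum => k.
    exact: measurable_funM.
  have := measurable_fun_ltr (@measurable_cst _ _ T R setT t) mg measurableT.
  by move=> /(_ [set true] I); rewrite setTI.
(* At this [t] the concentration exponent is exactly [8 ln p]. *)
have PA i : (P (A i) <= (C1 / p%:R ^+ 8)%:E)%E.
  have := covP i.1 i.2 t; rewrite t_gt0 t_le => /(_ isT)/le_trans; apply.
  rewrite lee_fin ler_wpM2l ?(ltW C10)//.
  rewrite (_ : _ / gamma ^+ 2 = - (8 * ln p%:R)); last first.
    rewrite -[8 * _ * _]mulrA tE; field; by rewrite !gt_eqF.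
  by rewrite expRN expRM_natl lnK.
have IW i : (\int[P]_w (W i w)%:E = 4%:E)%E.
  rewrite -(integral_expR_sqr_normal P (zs i) sg sg0 (mzs i) (zsP i)).
  by apply: eq_integral => w _; rewrite /W zsE.
(* Serves both estimators: [k = 1] for the thresholded matrix, [k = 4] for its projection. *)
have risk (f : T -> R) (k : R) : 0 <= k <= 4 -> (forall w, 0 <= f w) ->
    (forall w, f w <= k * spec_norm (hatS w - Sigma) ^+ 2) ->
    (\int[P]_w (f w)%:E <= (4 * C * rate)%:E)%E.
  move=> /andP[k0 k4] f0 fle.
  have := risk_bound_le_rate gamma l C1 eps L n%:R p%:R (ln p%:R) s%:R sg t.
  rewrite -/c1 -/c2 -/C -tauE => /(_ gamma0 l0 lL C10 eps0 eps1 lnp1).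
  rewrite !ler1n ler_nat => /(_ n1 np s1 sgE tE).
  set B := (X in X <= _) => Ble.
  apply: (@le_trans _ _ (k * B)%:E); last first.
    rewrite lee_fin -mulrA; apply: ler_pM => //.
    rewrite addr_ge0 ?sqr_ge0// mulr_ge0 ?mulr_ge0 ?(ltW P0)//.
    by rewrite addr_ge0// mulr_ge0// divr_ge0 ?exprn_ge0 ?(ltW C10) ?(ltW P0).
  have -> : k * B = k * (4 * s%:R * dp_tau gamma n p eps delta) ^+ 2 +
      #|{: 'I_p * 'I_p}|%:R * (k * c1 * (C1 / p%:R ^+ 8) + k * c2 * 4).
    by rewrite /B card_prod card_ord natrM -/c2; ring.
  apply: (integral_le_indic_sum P _ A W) => //.
  - by rewrite mulr_ge0 ?sqr_ge0.
  - by rewrite mulr_ge0.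
  - by rewrite mulr_ge0.
  - move=> i; apply: measurableT_comp => //; apply: measurable_funM => //.
    apply: measurable_funX; apply: measurable_funM => //.
    by have -> : (fun w => sym_noise (fun a b => z a b w) i.1 i.2) = zs i by
      apply/funext => w; exact: zsE.
  - by move=> i w; exact: expR_ge0.
  have : {ae P, forall w, forall i, \sum_(a < p) x i w a ^+ 2 <= 1}.
    exact: filter_forall.
  apply: filterS => w xw1.
  apply: le_trans (fle w) _.
  rewrite (eq_bigr (fun i => k * (c1 * \1_(A i) w + c2 * W i w))); last first.
    by move=> i _; ring.
  rewrite -mulr_sumr -mulrDr ler_wpM2l// /hatS tauE.
  apply: le_trans (spec_norm_threshold_sqr_le _ _ s t sg _ _ _ n1 p0 s1
    (ltW t_gt0) sg0 GS symS S1 xw1) _.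
  rewrite lerD2l ler_sum// => i _; rewrite lerD2r ler_wpM2l//.
  rewrite indicE; case: ltP => h; last by rewrite ler0n.
  by rewrite mem_set.
split.
- apply: (risk _ 1) => [|w|w]; first (by apply/andP; split; lra).
    exact: sqr_ge0.
  by rewrite mul1r.
- apply: (risk _ 4) => [|w|w]; first (by apply/andP; split; lra).
    exact: sqr_ge0.
  have -> : 4 * spec_norm (hatS w - Sigma) ^+ 2 =
      (2 * spec_norm (hatS w - Sigma)) ^+ 2 by ring.
  rewrite ler_pXn2r ?nnegrE ?mulr_ge0 ?spec_norm_ge0//.
  exact: spec_norm_psd_projection (SplusP w) psdS.
Qed.
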